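(* Let $\mathcal{G}$ be a multiplex network with agent set $V=\{1,\dots,n\}$, seed set $S_0\subseteq V$ and sequence of protocols $\mathcal{U}=(u_1,\dots,u_n)\in\{\mathrm{OR},\mathrm{AND}\}^n$. For every agent $i\notin S_0$, the probabilities of the following two events are the same: 1. $i$ is active at steady state for the multiplex linear threshold model (LTM) under $\mathcal{U}$ with random thresholds and initial active set $S_0$; 2. $i$ is $\mathcal{U}$-reachable from $S_0$ under the random multiplex selection of live edges in the multiplex live-edge model (LEM). That is, $\mathbb{P}^{\mathcal{G},\mathcal{U}}_{S_0}(\bar x_i=1)=r^{\mathcal{U}}_{iS_0}$.
   Context: Multiplex network: a family of $m\ge 1$ directed weighted graphs (layers) $G_k=(V,E^k)$, $k=1,\dots,m$, on a common agent set $V=\{1,\dots,n\}$. An edge $e^k_{i,j}\in E^k$ points from $i$ to $j$ (agent $i$ senses agent $j$ in layer $k$) and has weight $w^k_{i,j}>0$. $N_i^k=\{j: e^k_{i,j}\in E^k\}$ is the set of out-neighbors of $i$ in layer $k$, and $\sum_{j\in N_i^k}w^k_{i,j}=1$. It is assumed that each $i\notin S_0$ has at least one out-neighbor in each layer. Multiplex LTM: thresholds $\mu_i^k$ ($i\in V$, $k=1,\dots,m$) are drawn independently from the uniform distribution on $(0,1)$. $x_i(t)\in\{0,1\}$ is the state of agent $i$ at iteration $t$, and $S_t=\{i:x_i(t)=1\}$; initially $x_i(0)=1$ iff $i\in S_0$ (the seeds). For $t\ge1$ let $y_i^k(t)=1$ if $\mu_i^k<\sum_{j\in N_i^k\cap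 S_{t-1}}w^k_{i,j}$ and $y_i^k(t)=0$ otherwise. Then $x_i(t)=1$ if $x_i(t-1)=1$, or if $u_i=\mathrm{OR}$ and $y_i^k(t)=1$ for at least one $k$, or if $u_i=\mathrm{AND}$ and $y_i^k(t)=1$ for all $k$; otherwise $x_i(t)=0$. $\bar x_i=\lim_{t\to\infty}x_i(t)$, and $i$ is active at steady state if $\bar x_i=1$. $\mathbb{P}^{\mathcal{G},\mathcal{U}}_{S_0}$ is probability in this model. Multiplex LEM: in each layer $k$, each agent $i\notin S_0$ randomly (independently over agents and layers) selects exactly one of its outgoing edges, selecting $e^k_{i,j}$ with probability $w^k_{i,j}$; selected edges are ''live'' and all others ''blocked''. Seeds block all their outgoing edges. The choice of live edges is a multiplex selection of live edges; $L$ is the set of all of them, and $q_l$, the probability of $l\in L$, is the product of the weights of all live edges in $l$. Live-edge tree: given $l\in L$ and $i\notin S_0$, $T^l_i$ has root node $i$; if $e^k_{i,j_k}$ is the live edge of $i$ in layer $k$, the children of the root are $j_1,\dots,j_m$, each connected to the root by the corresponding live edge; the tree is continued recursively in the same way from each child that itself has live edges. An agent may appear several times as a node in the tree. $\mathcal{U}$-reachability: $\mathcal{B}^l_i$ is the set of distinct branches of $T^l_i$ that end in a seed, i.e. of the form $B=(i,e^{k_0}_{i,i_1},i_1,e^{k_1}_{i_1,i_2},i_2,\dots,i_s)$ with $i_s\in S_0$ and each agent of $V$ appearing at most once in $B$. For $\hat{\mathcal B}\subseteq\mathcal{B}^l_i$ let $\hat V$ be the set of agents in $\hat{\mathcal B}$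 and $\hat E$ the set of edges in $\hat{\mathcal B}$. $\hat{\mathcal B}$ is $\mathcal{U}$-feasible for $i$ if $\hat{\mathcal B}\ne\varnothing$ and for every $\hat i\in\hat V\setminus S_0$ with $u_{\hat i}=\mathrm{AND}$, all of $\hat i$'s live edges belong to $\hat E$. Agent $i$ is $\mathcal{U}$-reachable from $S_0$ by selection $l$ if some $\hat{\mathcal B}\subseteq\mathcal{B}^l_i$ is $\mathcal{U}$-feasible for $i$. $L^{\mathcal U}_{iS_0}$ is the set of all $l\in L$ by which $i$ is $\mathcal{U}$-reachable from $S_0$, and $r^{\mathcal U}_{iS_0}=\sum_{l\in L^{\mathcal U}_{iS_0}}q_l$ is the probability that $i$ is $\mathcal{U}$-reachable from $S_0$.
   Formalization: In U-feasibility, the agents and edges of a set of branches are taken as nodes and edges of the live-edge tree (repeated occurrences of an agent kept distinct); with occurrences merged, the claim fails, e.g. when two AND agents wait for each other. *)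

(* Defs.v *)
From HB Require Import structures.
From mathcomp Require Import all_boot all_order all_algebra.
From mathcomp Require Import all_classical all_reals all_analysis.
Set Implicit Arguments.
Unset Strict Implicit.
Unset Printing Implicit Defensive.
Import Order.TTheory GRing.Theory Num.Theory.
Import numFieldNormedType.Exports.
Local Open Scope classical_set_scope.
Local Open Scope ring_scope.

Inductive protocol := OR | AND.

(* Agents are 'I_n and layers 'I_m.  [edge G k i j] is the existence of the
   edge e^k_{i,j} (i senses j); [weight G k i j] is relevant only for edges. *)
Record multiplex (R : realType) (n m : nat) := Multiplex {
  edge : 'I_m -> rel 'I_n;
  weight : 'I_m -> 'I_n -> 'I_n -> R;
  weight_gt0 : forall k i j, edge k i j -> 0 < weight k i j;
  (* Agents without out-neighbours in a layer are exempt; seeds may be such. *)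
  weight_sum1 : forall k i, (exists j, edge k i j) ->
    \sum_(j | edge k i j) weight k i j = 1
}.

Section Probability.
Context d (T : measurableType d) (R : realType) (P : probability T R).

Definition mutually_independent (I : finType) (X : I -> {RV P >-> R}) :=
  forall (J : {set I}) (A : I -> set R), (forall i, measurable (A i)) ->
    P (\bigcap_(i in [set` J]) (X i @^-1` A i)) =
    (\prod_(i in J) P (X i @^-1` A i))%E.

Definition uniform01 (X : {RV P >-> R}) :=
  forall A : set R, measurable A ->
    distribution P X A = uniform_prob (@ltr01 R) A.

End Probability.

Section LTM.
Context (R : realType) (n m : nat) (G : multiplex R n m).
Context (u : 'I_n -> protocol) (S0 : {set 'I_n}).
Context (theta : 'I_n -> 'I_m -> R).

(* y_i^k, computed from the set S of agents active at the previous iteration *)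
Definition ltm_input (S : {set 'I_n}) (i : 'I_n) (k : 'I_m) : bool :=
  theta i k < \sum_(j in S | edge G k i j) weight G k i j.

Definition ltm_step (S : {set 'I_n}) : {set 'I_n} :=
  [set i | (i \in S) ||
    match u i with
    | OR => [exists k, ltm_input S i k]
    | AND => [forall k, ltm_input S i k]
    end]%SET.

Definition ltm_active (t : nat) : {set 'I_n} := iter t ltm_step S0.

Definition ltm_state (i : 'I_n) (t : nat) : R := (i \in ltm_active t)%:R.

Definition ltm_steady (i : 'I_n) : R := limn (ltm_state i).

End LTM.

Section LEM.
Context (R : realType) (n m : nat) (G : multiplex R n m).
Context (u : 'I_n -> protocol) (S0 : {set 'I_n}).

(* [l (i, k) = Some j] means that the live edge of i in layer k is e^k_{i,j};
   [l (i, k) = None] means that i has no live edge in layer k. *)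
Definition selection := {ffun 'I_n * 'I_m -> option 'I_n}.

Definition is_selection (l : selection) : bool :=
  [forall i, forall k,
    match l (i, k) with
    | Some j => (i \notin S0) && edge G k i j
    | None => i \in S0
    end].

Definition selection_prob (l : selection) : R :=
  \prod_i \prod_k match l (i, k) with
                  | Some j => weight G k i j
                  | None => 1
                  end.

(* The sequence [:: (k_0, i_1); (k_1, i_2); ...; (k_(s-1), i_s)] stands for the
   walk i, e^{k_0}_{i,i_1}, i_1, e^{k_1}_{i_1,i_2}, i_2, ..., i_s from i. *)
Definition walk := seq ('I_m * 'I_n).

Definition walk_end (i : 'I_n) (v : walk) : 'I_n := last i (unzip2 v).

Fixpoint live_walk (l : selection) (i : 'I_n) (v : walk) : bool :=
  if v is (k, j) :: v' then (l (i, k) == Some j) && live_walk l j v' else true.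

(* The (possibly infinite) tree T^l_i, given by its set of nodes: the node v is
   an occurrence of the agent [walk_end i v], and its children are the nodes
   [rcons v (k, j)] with e^k_{walk_end i v, j} live.  A branch is identified
   with its terminal node. *)
Definition live_edge_tree (l : selection) (i : 'I_n) : set walk :=
  [set v | live_walk l i v].

Definition branches (l : selection) (i : 'I_n) : set walk :=
  [set b | [/\ live_edge_tree l i b, walk_end i b \in S0
             & uniq (i :: unzip2 b)]].

(* The agents and edges of a set of branches are taken as nodes and edges of
   the tree: two occurrences of an agent are distinct nodes, each of which, for
   AND, needs all of its own outgoing tree edges.  (If occurrences were merged,
   two AND agents waiting for each other could be justified by one branch
   visiting them in one order and another visiting them in the other order,
   although neither can ever become active.)  An edge of the tree is given by
   its parent node and its step. *)
Definition branch_nodes (Bs : set walk) : set walk :=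
  [set v | exists2 b, Bs b & prefix v b].

Definition branch_edges (Bs : set walk) : set (walk * ('I_m * 'I_n)) :=
  [set e | exists2 b, Bs b & prefix (rcons e.1 e.2) b].

Definition feasible (l : selection) (i : 'I_n) (Bs : set walk) : Prop :=
  Bs !=set0 /\
  forall v, branch_nodes Bs v ->
    walk_end i v \notin S0 -> u (walk_end i v) = AND ->
    forall k j, l (walk_end i v, k) = Some j -> branch_edges Bs (v, (k, j)).

Definition reachable (l : selection) (i : 'I_n) : Prop :=
  exists2 Bs : set walk, Bs `<=` branches l i & feasible l i Bs.

Definition reach_prob (i : 'I_n) : R :=
  \sum_(l : selection | is_selection l && `[< reachable l i >])
    selection_prob l.

End LEM.

(* Main.v *)
Require Import Defs.
From mathcomp Require Import all_boot all_order all_algebra.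
From mathcomp Require Import all_classical all_reals all_analysis.
Set Implicit Arguments.
Unset Strict Implicit.
Unset Printing Implicit Defensive.
Import Order.TTheory GRing.Theory Num.Theory.
Import numFieldNormedType.Exports.
Local Open Scope classical_set_scope.
Local Open Scope ring_scope.

(* For fixed inputs, both models are the same monotone cascade: the input of
   agent i in layer k is a monotone boolean function of the active set, namely
   "the threshold is exceeded" in the LTM and "the live edge points to an active
   agent" in the LEM.  For a fixed selection, reachability is activation in that
   cascade: the depth of simple branches is bounded, which gives one direction,
   and the branches along which activation times decrease form a feasible set,
   which gives the other.  Inputs are independent over (i, k) in both models,
   and each has the same probability of being satisfied by any fixed set S: the
   total weight of the edges into S.  Their joint laws over several sets differ,
   but given the other inputs the limit of the cascade depends on the input at
   (i, k) only through its value at a single set (the limit reached when that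
   input is never satisfied), so the inputs of one model can be replaced by
   those of the other, one pair (i, k) at a time. *)

Section ProductExpectation.
Variables (R : comNzRingType) (X H : finType).
Implicit Types (p q : X -> H -> R) (F : {ffun X -> H} -> R).
Implicit Types (f : {ffun X -> H}) (x : X) (h : H).

Definition expect p F : R :=
  \sum_(f : {ffun X -> H}) (\prod_x p x (f x)) * F f.

Definition update f x h : {ffun X -> H} :=
  [ffun y => if y == x then h else f y].

(* The involution [(f, h) |-> (update f x h, f x)] exchanges the old and the
   new value at [x]. *)
Lemma expect_resample p q F x :
  (forall y, y != x -> p y =1 q y) -> \sum_h q x h = 1 ->
  expect p F = expect q (fun f => \sum_h p x h * F (update f x h)).
Proof.
move=> pq q1; rewrite /expect; apply/esym.
under eq_bigr do rewrite big_distrr.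
rewrite pair_bigA /= (reindex (fun z : {ffun X -> H} * H =>
  (update z.1 x z.2, z.1 x))) /=; last first.
  exists (fun z => (update z.1 x z.2, z.1 x)) => -[f h] _ /=;
  by congr pair; rewrite ?ffunE ?eqxx //; apply/ffunP => y; rewrite !ffunE;
    case: eqP => [->|].
rewrite -[LHS](pair_bigA _ (fun f h => \prod_y q y (update f x h y) *
  (p x (f x) * F (update (update f x h) x (f x))))) /=.
apply: eq_bigr => f _; rewrite -[in RHS](mul1r (\prod_y _ * _)) -q1 big_distrl.
apply: eq_bigr => h _ /=.
have -> : update (update f x h) x (f x) = f.
  by apply/ffunP => y; rewrite !ffunE; case: eqP => [->|].
rewrite (bigD1 x) //= ffunE eqxx [in RHS](bigD1 x) //= -!mulrA; congr (_ * _).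
rewrite mulrCA; congr (_ * (_ * _)); apply: eq_bigr => y yx.
by rewrite ffunE (negPf yx) pq.
Qed.

Lemma expect_exchange p q F :
  (forall x, \sum_h p x h = 1) -> (forall x, \sum_h q x h = 1) ->
  (forall x f, \sum_h p x h * F (update f x h) =
               \sum_h q x h * F (update f x h)) ->
  expect p F = expect q F.
Proof.
move=> p1 q1 pq; pose r (s : seq X) x h := if x \in s then q x h else p x h.
have r1 s x : \sum_h r s x h = 1 by rewrite /r; case: (x \in s).
have rF s x f : \sum_h r s x h * F (update f x h) =
    \sum_h p x h * F (update f x h).
  by rewrite /r; case: (x \in s).
suff rE s : expect (r s) F = expect p F.
  rewrite -(rE (enum X)) /expect; apply: eq_bigr => f _.
  by congr (_ * _); apply: eq_bigr => x _; rewrite /r mem_enum.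
elim: s => [|x s <-]; first by apply: eq_bigr.
rewrite !(@expect_resample (r _) (r s) F x) //.
  by apply: eq_bigr => f _; rewrite !rF.
by move=> y yx h; rewrite /r inE (negPf yx).
Qed.

Lemma sum_pred_split (Q : pred H) (r : H -> R) (F : bool -> R) :
  \sum_h r h * F (Q h) =
  (\sum_(h | Q h) r h) * F true + (\sum_h r h - \sum_(h | Q h) r h) * F false.
Proof.
rewrite [\sum_h r h](bigID Q) /= addrAC subrr add0r (bigID Q) /=.
rewrite !big_distrl /=.
by congr (_ + _); apply: eq_bigr => h; [move=> -> | move=> /negPf ->].
Qed.

End ProductExpectation.

Section Cascade.
Variables (n m : nat) (u : 'I_n -> protocol) (S0 : {set 'I_n}).

Definition input_mono (h : {ffun {set 'I_n} -> bool}) :=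
  [forall S : {set 'I_n}, forall S' : {set 'I_n},
    (S \subset S') ==> (h S ==> h S')].

Definition input_fun := {h : {ffun {set 'I_n} -> bool} | input_mono h}.

Lemma input_funS (h : input_fun) (S S' : {set 'I_n}) :
  S \subset S' -> val h S -> val h S'.
Proof.
move=> SS'; apply/implyP; move: (valP h) => /= /forallP/(_ S)/forallP/(_ S').
by rewrite SS'.
Qed.

Lemma cst_input_mono b : input_mono [ffun=> b].
Proof.
by apply/forallP=> S; apply/forallP=> S'; rewrite !ffunE !implybb implybT.
Qed.

Definition cst_input b : input_fun := exist input_mono _ (cst_input_mono b).

Lemma cst_inputE b S : val (cst_input b) S = b.
Proof. by rewrite ffunE. Qed.

Definition inputs := {ffun 'I_n * 'I_m -> input_fun}.
Implicit Types (f : inputs) (S C : {set 'I_n}) (i j : 'I_n) (k : 'I_m).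

Definition cascade_step f S : {set 'I_n} :=
  [set i | (i \in S) ||
    match u i with
    | OR => [exists k, val (f (i, k)) S]
    | AND => [forall k, val (f (i, k)) S]
    end]%SET.

Definition cascade f t := iter t (cascade_step f) S0.

(* Iterating from [S0 :|: _] rather than from [S0] makes the limit a least
   fixed point in the sense of [fixset]. *)
Definition cascade_limit f := fixset (fun S => cascade_step f (S0 :|: S)).

Lemma cascade_step_le f f' S S' :
  S \subset S' -> (forall x, val (f x) S -> val (f' x) S') ->
  cascade_step f S \subset cascade_step f' S'.
Proof.
move=> /fintype.subsetP SS' ff'; apply/fintype.subsetP => i; rewrite !inE.
case/orP => [/SS' -> //|fi]; apply/orP; right.
case: (u i) fi => [/existsP[k ?]|/forallP fi].
  by apply/existsP; exists k; apply: ff'.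
by apply/forallP => k; apply: ff'.
Qed.

Lemma sub_cascade_step f S : S \subset cascade_step f S.
Proof. by apply/fintype.subsetP => i iS; rewrite inE iS. Qed.

Lemma cascade_homo f :
  {homo (fun S => cascade_step f (S0 :|: S)) : S S' / S \subset S'}.
Proof.
move=> S S' SS'; apply: cascade_step_le => [|x]; first exact: finset.setUS.
by apply: input_funS; apply: finset.setUS.
Qed.

Lemma sub_cascade_limit f : S0 \subset cascade_limit f.
Proof.
rewrite -[cascade_limit f](fixsetK (@cascade_homo f)).
by apply: fintype.subset_trans (sub_cascade_step _ _); apply: finset.subsetUl.
Qed.

Lemma cascade_limit_closed f :
  cascade_step f (cascade_limit f) = cascade_limit f.
Proof.
rewrite -{2}[cascade_limit f](fixsetK (@cascade_homo f)).
by rewrite (finset.setUidPr (sub_cascade_limit f)).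
Qed.

Lemma cascade_sub f s t : (s <= t)%N -> cascade f s \subset cascade f t.
Proof.
move=> /subnK <-; elim: (_ - s)%N => [|d IH] //=.
exact: fintype.subset_trans IH (sub_cascade_step _ _).
Qed.

Lemma cascade_sub_closed f C t : S0 \subset C -> cascade_step f C \subset C ->
  cascade f t \subset C.
Proof.
move=> S0C fC; elim: t => [//|t IH] /=; apply: fintype.subset_trans fC.
by apply: cascade_step_le => // x; apply: input_funS.
Qed.

Lemma cascade_limitP f i :
  reflect (exists t, i \in cascade f t) (i \in cascade_limit f).
Proof.
apply: (iffP idP) => [/fix_order_proof[t it]|[t]].
  suff sub s : iter s (fun S => cascade_step f (S0 :|: S)) finset.set0
      \subset cascade f s by exists t; apply: (fintype.subsetP (sub t)).
  elim: s => [|s IH]; first exact: finset.sub0set.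
  have S0s : S0 \subset cascade f s by exact: (@cascade_sub f 0).
  have US : S0 :|: iter s (fun S => cascade_step f (S0 :|: S)) finset.set0
    \subset cascade f s by rewrite finset.subUset S0s.
  by apply: (cascade_step_le US) => x; apply: input_funS.
apply/fintype.subsetP; apply: cascade_sub_closed.
  exact: sub_cascade_limit.
by rewrite cascade_limit_closed.
Qed.

Lemma cascade_limit_min f C : S0 \subset C -> cascade_step f C \subset C ->
  cascade_limit f \subset C.
Proof.
move=> S0C fC; apply/fintype.subsetP => i /cascade_limitP[t].
exact/fintype.subsetP/cascade_sub_closed.
Qed.

Lemma cascade_limit_le f f' :
  (forall x, val (f x) (cascade_limit f') -> val (f' x) (cascade_limit f')) ->
  cascade_limit f \subset cascade_limit f'.
Proof.
move=> ff'; apply: cascade_limit_min; first exact: sub_cascade_limit.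
apply: fintype.subset_trans (cascade_step_le (fintype.subxx _) ff') _.
by rewrite cascade_limit_closed.
Qed.

(* Before the input [h] at [x] is satisfied, the cascade agrees with the one in
   which it is never satisfied, so [h] matters only at the limit of that one. *)
Lemma cascade_limit_update f x (h : input_fun) :
  cascade_limit (update f x h) =
  cascade_limit (update f x
    (cst_input (val h (cascade_limit (update f x (cst_input false)))))).
Proof.
set C0 := cascade_limit (update f x (cst_input false)).
have le (h1 h2 : input_fun) (C := cascade_limit (update f x h2)) :
    (val h1 C -> val h2 C) -> cascade_limit (update f x h1) \subset C.
  move=> h12; apply: cascade_limit_le => y; rewrite !ffunE.
  by case: ifP => // _; apply: h12.
suff H b : val h C0 = b -> cascade_limit (update f x h) =
    cascade_limit (update f x (cst_input b)) by exact: H.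
case: b => hC0; apply/eqP; rewrite finset.eqEsubset; apply/andP; split.
- by apply: (le); rewrite cst_inputE.
- apply: (le) => _; apply: input_funS hC0.
  by apply: (le); rewrite cst_inputE.
- by apply: (le); rewrite -/C0 hC0.
- by apply: (le); rewrite cst_inputE.
Qed.

Lemma expect_cascade_limit (R : comNzRingType)
    (p q : 'I_n * 'I_m -> input_fun -> R) i :
  (forall x, \sum_h p x h = 1) -> (forall x, \sum_h q x h = 1) ->
  (forall x (S : {set 'I_n}),
    \sum_(h : input_fun | val h S) p x h =
    \sum_(h : input_fun | val h S) q x h) ->
  expect p (fun f => (i \in cascade_limit f)%:R) =
  expect q (fun f => (i \in cascade_limit f)%:R).
Proof.
move=> p1 q1 pq; apply: expect_exchange => // x f.
set C0 := cascade_limit (update f x (cst_input false)).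
pose F b : R := (i \in cascade_limit (update f x (cst_input b)))%:R.
have split (r : 'I_n * 'I_m -> input_fun -> R) :
    \sum_h r x h * (i \in cascade_limit (update f x h))%:R =
    (\sum_(h : input_fun | val h C0) r x h) * F true +
    (\sum_h r x h - \sum_(h : input_fun | val h C0) r x h) * F false.
  rewrite -sum_pred_split; apply: eq_bigr => h _.
  exact: (congr1 (fun C : {set 'I_n} => r x h * (i \in C)%:R)
           (cascade_limit_update f x h)).
by rewrite (split p) (split q) p1 q1 pq.
Qed.

End Cascade.

Section LiveEdges.
Variables (n m : nat) (u : 'I_n -> protocol) (S0 : {set 'I_n}).

Lemma live_input_mono (o : option 'I_n) :
  input_mono [ffun S : {set 'I_n} => if o is Some j then j \in S else false].
Proof.
apply/forallP=> S; apply/forallP=> S'; rewrite !ffunE.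
apply/implyP => /fintype.subsetP SS'; apply/implyP; case: o => // j; exact: SS'.
Qed.

Definition live_input (o : option 'I_n) : input_fun n :=
  exist (@input_mono n) _ (live_input_mono o).

Lemma live_inputE o (S : {set 'I_n}) :
  val (live_input o) S = if o is Some j then j \in S else false.
Proof. by rewrite ffunE. Qed.

Definition live_inputs (l : selection n m) : inputs n m :=
  [ffun x => live_input (l x)].

Variables (R : realType) (G : multiplex R n m) (l : selection n m).
Hypothesis lS : is_selection G S0 l.

Local Notation A := (cascade u S0 (live_inputs l)).
Local Notation C := (cascade_limit u S0 (live_inputs l)).

Lemma live_edge_ex i k : i \notin S0 -> exists j, l (i, k) = Some j.
Proof.
move: lS => /forallP/(_ i)/forallP/(_ k); case: (l (i, k)) => [j _ _|->//].
by exists j.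
Qed.

Lemma live_walk_cat i v w :
  live_walk l i (v ++ w) = live_walk l i v && live_walk l (walk_end i v) w.
Proof. by elim: v i => [//|[k j] v IH] i /=; rewrite IH andbA. Qed.

Lemma walk_end_cat (i : 'I_n) (v w : walk n m) :
  walk_end i (v ++ w) = walk_end (walk_end i v) w.
Proof. by rewrite /walk_end /unzip2 map_cat last_cat. Qed.

Lemma branch_node_reached i (Bs : set (walk n m)) (v : walk n m) :
  Bs `<=` branches S0 l i -> feasible u S0 l i Bs -> branch_nodes Bs v ->
  walk_end i v \in C.
Proof.
move=> Bsub [_ Bfeas].
have [d] : exists d, (n <= size v + d)%N by exists n; rewrite leq_addl.
elim: d v => [|d IH] v vd [b Bb /prefixP[c bE]].
  have [_ _ /card_uniqP/=] := Bsub _ Bb; rewrite size_map => cb.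
  have := max_card (mem (i :: unzip2 b)); rewrite cb card_ord bE size_cat.
  by rewrite addn0 in vd => /leq_trans/(_ vd); rewrite ltnNge leq_addr.
have [vS0|vS0] := boolP (walk_end i v \in S0).
  by apply: (fintype.subsetP (sub_cascade_limit _ _ _)).
rewrite -cascade_limit_closed inE; apply/orP; right.
have child k j : l (walk_end i v, k) = Some j ->
    branch_nodes Bs (rcons v (k, j)) ->
    val (live_inputs l (walk_end i v, k)) C.
  move=> lj Bj; rewrite ffunE live_inputE lj.
  have := IH _ _ Bj; rewrite -cats1 walk_end_cat; apply.
  by rewrite size_cat addn1 addSnnS.
case uv: (u _).
  have [lb bS0 _] := Bsub _ Bb.
  case: c bE => [|[k j] c] bE.
    by rewrite bE cats0 (negPf vS0) in bS0.
  move: lb; rewrite /live_edge_tree /= bE live_walk_cat /=.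
  move=> /and3P[_ /eqP lj _].
  apply/existsP; exists k; apply: (child k j) => //; exists b => //.
  by rewrite bE -cat_rcons prefix_prefix.
apply/forallP => k; have [j lj] := live_edge_ex k vS0.
apply: (child k j lj).
have [] := Bfeas v _ vS0 uv k j lj.
  by exists b => //; rewrite bE prefix_prefix.
by move=> b' Bb' vb'; exists b'.
Qed.

(* [earlier j i]: the cascade reaches [j] strictly before [i].  The branches on
   which activation times decrease are automatically simple. *)
Definition earlier (i j : 'I_n) : bool :=
  `[< exists2 t, j \in A t & i \notin A t >].

Lemma earlier_irr : irreflexive earlier.
Proof. by move=> i; apply/negP => /asboolP[t ->]. Qed.

Lemma earlier_trans : transitive earlier.
Proof.
move=> j i k /asboolP[t jt it] /asboolP[s ks js]; apply/asboolP; exists t => //.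
have [ts|st] := leqP t s.
  have /fintype.subsetP/(_ _ jt) := cascade_sub u S0 (live_inputs l) ts.
  by rewrite (negPf js).
by have /fintype.subsetP := cascade_sub u S0 (live_inputs l) (ltnW st); apply.
Qed.

Definition earlier_branches (i : 'I_n) : set (walk n m) :=
  [set b | [/\ live_walk l i b, walk_end i b \in S0
             & path earlier i (unzip2 b)]].

Lemma earlier_branches_sub i : earlier_branches i `<=` branches S0 l i.
Proof.
move=> b [lb bS0 pb]; split=> //.
by apply: (sorted_uniq earlier_trans earlier_irr); exact: pb.
Qed.

Hypothesis hm : (0 < m)%N.

Lemma active_child t i : i \notin A t -> i \in A t.+1 ->
  match u i with
  | OR => exists k, exists2 j, l (i, k) = Some j & j \in A t
  | AND => forall k, exists2 j, l (i, k) = Some j & j \in A t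
  end.
Proof.
move=> iNt; rewrite /= inE (negPf iNt) /=.
have inputP k : val (live_inputs l (i, k)) (A t) ->
    exists2 j, l (i, k) = Some j & j \in A t.
  by rewrite ffunE live_inputE; case: (l _) => // j jt; exists j.
case: (u i) => [/existsP[k /inputP]|/forallP H k]; first by exists k.
exact/inputP/H.
Qed.

Lemma earlier_branch_ex t i : i \in A t -> exists b, earlier_branches i b.
Proof.
elim: t i => [|t IH] i it; first by exists [::].
have [/IH//|iNt] := boolP (i \in A t).
have [k [j lj jt]] : exists k, exists2 j, l (i, k) = Some j & j \in A t.
  have := active_child iNt it.
  by case: (u i) => // /(_ (Ordinal hm)); exists (Ordinal hm).
have [b [lb bS0 pb]] := IH _ jt; exists ((k, j) :: b); split => //=.
  by rewrite lj eqxx.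
by rewrite pb andbT; apply/asboolP; exists t.
Qed.

Lemma earlier_branches_feasible i :
  i \in C -> feasible u S0 l i (earlier_branches i).
Proof.
move=> /cascade_limitP iC; split.
  by have [t it] := iC; apply: earlier_branch_ex it.
move=> v [b [lb bS0 pb] /prefixP[c bE]] vS0 uv k j lj; subst b.
move: lb pb; rewrite live_walk_cat /unzip2 map_cat cat_path -/unzip2.
move=> /andP[lv _] /andP[pv _].
have [t vt] : exists t, walk_end i v \in A t.
  move: pv; rewrite /walk_end /unzip2; case/lastP: (map _ v) => [//|p x].
  by rewrite rcons_path last_rcons => /andP[_ /asboolP[t xt _]]; exists t.
elim: t vt => [|t IH] vt; first by rewrite vt in vS0.
have [/IH//|vNt] := boolP (walk_end i v \in A t).
have := active_child vNt vt; rewrite uv => /(_ k)[j']; rewrite lj => -[<-] jt.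
have [b [lb jS0 pb]] := earlier_branch_ex jt.
exists (v ++ (k, j) :: b); last by rewrite /= -cat_rcons prefix_prefix.
split.
- by rewrite live_walk_cat lv /= lj eqxx.
- by rewrite walk_end_cat.
- rewrite /unzip2 map_cat cat_path pv /= pb andbT; apply/asboolP; by exists t.
Qed.

Lemma reachable_cascade i : reachable u S0 l i <-> i \in C.
Proof.
split=> [[Bs Bsub Bfeas]|iC].
  have [b Bb] := Bfeas.1.
  apply: (@branch_node_reached i Bs [::]) => //.
  by exists b => //; rewrite prefix0s.
exists (earlier_branches i); first exact: earlier_branches_sub.
exact: earlier_branches_feasible.
Qed.

End LiveEdges.

Section LiveEdgeDistribution.
Variables (R : realType) (n m : nat) (G : multiplex R n m).
Variables (u : 'I_n -> protocol) (S0 : {set 'I_n}).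

Definition sensed_weight (x : 'I_n * 'I_m) (S : {set 'I_n}) : R :=
  \sum_(j in S | edge G x.2 x.1 j) weight G x.2 x.1 j.

Lemma sensed_weightS x (S S' : {set 'I_n}) :
  S \subset S' -> sensed_weight x S <= sensed_weight x S'.
Proof.
move=> /fintype.subsetP SS'; rewrite /sensed_weight big_mkcond.
rewrite [leRHS]big_mkcond; apply: ler_sum => j _.
case: ifP => [/andP[/SS' -> ->]//|_].
by case: ifP => // /andP[_ /weight_gt0/ltW].
Qed.

Lemma sensed_weight_ge0 x S : 0 <= sensed_weight x S.
Proof. by apply: sumr_ge0 => j /andP[_ /weight_gt0/ltW]. Qed.

Lemma sensed_weightT x : (exists j, edge G x.2 x.1 j) ->
  sensed_weight x [set: 'I_n]%SET = 1.
Proof.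
move=> /weight_sum1 <-; apply: eq_bigl => j; by rewrite finset.in_setT.
Qed.

Definition choice_ok (x : 'I_n * 'I_m) (o : option 'I_n) : bool :=
  match o with
  | Some j => (x.1 \notin S0) && edge G x.2 x.1 j
  | None => x.1 \in S0
  end.

Definition choice_weight (x : 'I_n * 'I_m) (o : option 'I_n) : R :=
  if o is Some j then weight G x.2 x.1 j else 1.

Definition live_prob (x : 'I_n * 'I_m) (h : input_fun n) : R :=
  \sum_(o | choice_ok x o && (live_input o == h)) choice_weight x o.

Lemma sum_live_prob x (Q : pred (input_fun n)) :
  \sum_(h | Q h) live_prob x h =
  \sum_(o | choice_ok x o && Q (live_input o)) choice_weight x o.
Proof.
rewrite (partition_big (@live_input n) Q) /=; last by move=> o /andP[].
apply: eq_bigr => h Qh; apply: eq_bigl => o.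
by case: eqP => [->|]; rewrite ?andbF // Qh !andbT.
Qed.

Lemma sum_choice_weight x (Q : pred (option 'I_n)) :
  \sum_(o | choice_ok x o && Q o) choice_weight x o =
  if x.1 \in S0 then (Q None)%:R
  else \sum_(j | edge G x.2 x.1 j && Q (Some j)) weight G x.2 x.1 j.
Proof.
case: ifPn => xS0.
  rewrite big_mkcond (bigD1 None) //= xS0 /= big1 => [|[j|]//].
    by rewrite addr0; case: (Q _).
  by rewrite /= xS0.
rewrite (reindex_omap (@Some 'I_n) id) /=; last first.
  by move=> [j|] //; rewrite /= (negPf xS0).
by apply: eq_bigl => j; rewrite xS0 eqxx andbT.
Qed.

Hypothesis hG :
  forall (i : 'I_n) (k : 'I_m), i \notin S0 -> exists j, edge G k i j.

Lemma live_prob_total x : \sum_h live_prob x h = 1.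
Proof.
rewrite sum_live_prob sum_choice_weight; case: ifPn => // xS0.
by rewrite -(weight_sum1 (hG x.2 xS0)); apply: eq_bigl => j; rewrite andbT.
Qed.

Lemma live_prob_marginal x (S : {set 'I_n}) :
  \sum_(h : input_fun n | val h S) live_prob x h =
  if x.1 \in S0 then 0 else sensed_weight x S.
Proof.
rewrite (sum_live_prob x (fun h : input_fun n => val h S)).
rewrite (sum_choice_weight x (fun o => val (live_input o) S)).
rewrite live_inputE; case: ifP => // _.
by apply: eq_bigl => j; rewrite live_inputE andbC.
Qed.

Lemma is_selectionE (l : selection n m) :
  is_selection G S0 l = (l \in family choice_ok).
Proof.
apply/idP/familyP => [/forallP H [i k]|H].
  by have /forallP/(_ k) := H i.
by apply/forallP => i; apply/forallP => k; have := H (i, k).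
Qed.

Lemma reach_prob_expect i : (0 < m)%N ->
  reach_prob G u S0 i =
  expect live_prob (fun f => (i \in cascade_limit u S0 f)%:R).
Proof.
move=> hm; rewrite /expect /live_prob.
under [RHS]eq_bigr do rewrite bigA_distr_big_dep big_distrl /=.
rewrite /reach_prob big_mkcondr /=.
rewrite (partition_big (@live_inputs n m) xpredT) //=; apply: eq_bigr => f _.
apply: eq_big => [l|l /andP[lS /eqP <-]].
  rewrite is_selectionE; apply/andP/familyP => [[/familyP lok /eqP <-] x|H].
    by rewrite unfold_in ffunE eqxx andbT; exact: lok.
  split; first by apply/familyP => x; have /andP[] := H x.
  apply/eqP/ffunP => x; rewrite ffunE; by have /andP[_ /eqP] := H x.
have -> : `[< reachable u S0 l i >] =
    (i \in cascade_limit u S0 (live_inputs l)).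
  by apply/asboolP/idP => /(reachable_cascade u lS hm).
rewrite /selection_prob pair_bigA /=; case: (i \in _); rewrite ?mulr1 ?mulr0 //.
by apply: eq_bigr => -[j k] _; rewrite /choice_weight; case: (l _).
Qed.

End LiveEdgeDistribution.

Lemma measurable_lt_test (R : realType) (a : R) (b c : bool) :
  measurable [set t | c && (t < a) = b].
Proof.
have mlt : measurable [set t | t < a].
  by rewrite -set_itvNyo; exact: measurable_itv.
case: c b => [] [] /=.
- exact: mlt.
- rewrite (_ : [set _ | _] = ~` [set t | t < a]); first exact: measurableC.
  by apply/seteqP; split => t /=; [move=> -> | move/negP/negPf].
- by rewrite (_ : [set _ | _] = set0) //; apply/seteqP; split.
- by rewrite (_ : [set _ | _] = setT) //; apply/seteqP; split.
Qed.

Section Thresholds.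
Variables (R : realType) (n m : nat) (G : multiplex R n m).
Variables (u : 'I_n -> protocol) (S0 : {set 'I_n}).

Lemma threshold_input_mono (x : 'I_n * 'I_m) (t : R) :
  input_mono
    [ffun S : {set 'I_n} => (x.1 \notin S0) && (t < sensed_weight G x S)].
Proof.
apply/forallP=> S; apply/forallP=> S'; rewrite !ffunE.
apply/implyP => SS'; apply/implyP => /andP[-> /lt_le_trans]; apply.
exact: sensed_weightS.
Qed.

(* Seeds are given the never satisfied input, as in the live-edge model: their
   thresholds are irrelevant to the dynamics but would spoil the equality of
   the marginals. *)
Definition threshold_input (x : 'I_n * 'I_m) (t : R) : input_fun n :=
  exist (@input_mono n) _ (threshold_input_mono x t).

Lemma threshold_inputE x t (S : {set 'I_n}) :
  val (threshold_input x t) S = (x.1 \notin S0) && (t < sensed_weight G x S).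
Proof. by rewrite ffunE. Qed.

Definition threshold_inputs (theta : 'I_n -> 'I_m -> R) : inputs n m :=
  [ffun x => threshold_input x (theta x.1 x.2)].

Lemma ltm_active_cascade theta t :
  ltm_active G u S0 theta t = cascade u S0 (threshold_inputs theta) t.
Proof.
elim: t => [//|t IH].
rewrite /ltm_active /cascade !iterS.
rewrite -/(ltm_active _ _ _ _ _) -/(cascade _ _ _ _) IH.
set f := threshold_inputs theta.
apply/setP => i; rewrite !inE.
have [|iS0] := boolP (i \in S0).
  by move/(fintype.subsetP (cascade_sub u S0 f (leq0n t))) => ->.
have inputE k : ltm_input G theta (cascade u S0 f t) i k =
    val (f (i, k)) (cascade u S0 f t).
  by rewrite ffunE threshold_inputE iS0.
by congr orb; case: (u i); [apply: eq_existsb | apply: eq_forallb].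
Qed.

Lemma ltm_steadyP theta i : ltm_steady G u S0 theta i = 1 <->
  i \in cascade_limit u S0 (threshold_inputs theta).
Proof.
split=> [|/cascade_limitP[t it]].
  apply: contraPT => /cascade_limitP iN; rewrite /ltm_steady.
  rewrite (_ : ltm_state _ _ _ _ _ = fun=> 0).
    by rewrite lim_cst //; apply/eqP; rewrite eq_sym oner_eq0.
  apply/funext => t; rewrite /ltm_state ltm_active_cascade.
  by case: (boolP (i \in _)) => // it; case: iN; exists t.
apply: lim_near_cst => //; exists t => // s /= ts.
rewrite /ltm_state ltm_active_cascade.
by rewrite (fintype.subsetP (cascade_sub _ _ _ ts) _ it).
Qed.

Lemma measurable_threshold_input x (h : input_fun n) :
  measurable [set t | threshold_input x t = h].
Proof.
have -> : [set t | threshold_input x t = h] =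
    \bigcap_(S in [set: {set 'I_n}])
      [set t | val (threshold_input x t) S = val h S].
  apply/seteqP; split => [t /= <- //|t /= H].
  by apply/val_inj/ffunP => S; exact: H.
apply: fin_bigcap_measurable => // S _.
under eq_set do rewrite threshold_inputE.
exact: measurable_lt_test.
Qed.

End Thresholds.

Lemma measure_preimage_finType d (T : measurableType d) (R : realType)
    (P : {measure set T -> \bar R}) (K : finType) (h : T -> K) (Q : pred K) :
  (forall k, measurable [set w | h w = k]) ->
  P [set w | Q (h w)] = (\sum_(k | Q k) P [set w | h w = k])%E.
Proof.
move=> mh; have -> : [set w | Q (h w)] =
    \bigcup_(k in [set` Q]) [set w | h w = k].
  apply/seteqP; split => [w Qw|w [k Qk /= ->]] //; by exists (h w).
rewrite measure_fin_bigcup //; last by move=> k1 k2 _ _ [w [/= -> ->]].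
by apply/esym/bigfs => [|k _]; rewrite ?index_enum_uniq ?mem_index_enum.
Qed.

Lemma uniform01_lt d (T : measurableType d) (R : realType) (P : probability T R)
    (X : {RV P >-> R}) (a : R) : uniform01 X -> 0 <= a <= 1 ->
  P [set w | X w < a] = a%:E.
Proof.
move=> uX /andP[a0 a1].
have := uX `]-oo, a[%classic (measurable_itv _).
rewrite /distribution /pushforward /= => uXa.
rewrite (_ : [set w | X w < a] = X @^-1` `]-oo, a[); last first.
  by apply/seteqP; split => w /=; rewrite in_itv.
rewrite uXa /uniform_prob integral_uniform_pdf.
rewrite (_ : _ `&` _ = `[0, a[%classic); last first.
  apply/seteqP; split => t /=; rewrite !in_itv /=.
    by move=> [ta /andP[-> _]].
  by move=> /andP[-> ta]; rewrite ta (le_trans (ltW ta)).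
rewrite (eq_integral (fun=> 1%:E)); last first.
  move=> t; rewrite inE /= in_itv /= => /andP[t0 ta].
  by rewrite /uniform_pdf t0 (le_trans (ltW ta)) //= subr0 invr1.
rewrite integral_cst //= mul1e lebesgue_measure_itv /= lte_fin oppr0 adde0.
by case: ltgtP a0 => // <-.
Qed.

Section ThresholdDistribution.
Variables (R : realType) (n m : nat) (G : multiplex R n m).
Variables (u : 'I_n -> protocol) (S0 : {set 'I_n}).
Hypothesis hG :
  forall (i : 'I_n) (k : 'I_m), i \notin S0 -> exists j, edge G k i j.
Variables (d : measure_display) (T : measurableType d) (P : probability T R).
Variable mu : 'I_n -> 'I_m -> {RV P >-> R}.
Hypothesis mu_unif : forall i k, uniform01 (mu i k).
Hypothesis mu_indep : mutually_independent (fun p : 'I_n * 'I_m => mu p.1 p.2).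

Local Notation W w := (threshold_inputs G S0 (fun j k => mu j k w)).
Local Notation H x w := (threshold_input G S0 x (mu x.1 x.2 w)).

Definition threshold_prob (x : 'I_n * 'I_m) (h : input_fun n) : R :=
  fine (P [set w | H x w = h]).

Lemma measurable_threshold_event x h : measurable [set w | H x w = h].
Proof.
have := measurable_funPTI (mu x.1 x.2) (measurable_threshold_input G S0 x h).
exact.
Qed.

Lemma threshold_probE x h : P [set w | H x w = h] = (threshold_prob x h)%:E.
Proof.
by rewrite fineK // fin_num_measure //; exact: measurable_threshold_event.
Qed.

Lemma sum_threshold_prob x (Q : pred (input_fun n)) :
  (\sum_(h | Q h) threshold_prob x h)%:E = P [set w | Q (H x w)].
Proof.
rewrite -sumEFin (measure_preimage_finType P (h := fun w => H x w)); last first.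
  exact: measurable_threshold_event.
apply: eq_bigr => h _; exact/esym/threshold_probE.
Qed.

Lemma threshold_prob_total x : \sum_h threshold_prob x h = 1.
Proof.
apply: EFin_inj; rewrite sum_threshold_prob -(@probability_setT _ _ _ P).
by congr (P _); apply/seteqP.
Qed.

Lemma threshold_prob_marginal x (S : {set 'I_n}) :
  \sum_(h : input_fun n | val h S) threshold_prob x h =
  if x.1 \in S0 then 0 else sensed_weight G x S.
Proof.
apply: EFin_inj.
rewrite (sum_threshold_prob x (fun h : input_fun n => val h S)).
under eq_set do rewrite threshold_inputE.
case: ifPn => xS0 /=.
  by rewrite (_ : [set _ | _] = set0) ?measure0 //; apply/seteqP; split.
rewrite uniform01_lt // sensed_weight_ge0 -(sensed_weightT (hG x.2 xS0)).
by rewrite sensed_weightS // finset.subsetT.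
Qed.

Lemma ltm_prob_expect i :
  P [set w | ltm_steady G u S0 (fun j k => mu j k w) i = 1] =
  (expect threshold_prob (fun f => (i \in cascade_limit u S0 f)%:R))%:E.
Proof.
have -> : [set w | ltm_steady G u S0 (fun j k => mu j k w) i = 1] =
    [set w | i \in cascade_limit u S0 (W w)].
  by apply/seteqP; split => w /= /ltm_steadyP.
have WE f : [set w | W w = f] =
    \bigcap_(x in [set` [set: 'I_n * 'I_m]%SET])
      (mu x.1 x.2 @^-1` [set t | threshold_input G S0 x t = f x]).
  apply/seteqP; split => [w /= <- x _|w /= H]; first by rewrite /= ffunE.
  by apply/ffunP => x; rewrite ffunE; apply: H; rewrite /= finset.in_setT.
rewrite (measure_preimage_finType P (h := fun w => W w)
  (fun f => i \in cascade_limit u S0 f)); last first.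
  move=> f; rewrite WE; apply: fin_bigcap_measurable => // x _.
  exact: measurable_threshold_event.
rewrite /expect big_mkcond -sumEFin; apply: eq_bigr => f _.
case: (i \in _); last by rewrite mulr0.
rewrite mulr1 WE.
have := @mu_indep [set: _]%SET
  (fun x => [set t | threshold_input G S0 x t = f x])
  (fun x => measurable_threshold_input G S0 x (f x)).
move=> /= ->; rewrite -prodEFin.
apply: eq_big => [x|x _]; first by rewrite finset.in_setT.
exact: threshold_probE.
Qed.

End ThresholdDistribution.

Theorem theorem1 (R : realType) (n m : nat) (hm : (0 < m)%N)
  (G : multiplex R n m) (S0 : {set 'I_n}) (u : 'I_n -> protocol)
  (hG : forall (i : 'I_n) (k : 'I_m), i \notin S0 -> exists j, edge G k i j)
  (d : measure_display) (T : measurableType d) (P : probability T R)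
  (mu : 'I_n -> 'I_m -> {RV P >-> R})
  (mu_unif : forall i k, uniform01 (mu i k))
  (mu_indep : mutually_independent (fun p : 'I_n * 'I_m => mu p.1 p.2))
  (i : 'I_n) (hi : i \notin S0) :
  P [set w | ltm_steady G u S0 (fun j k => mu j k w) i = 1] =
  (reach_prob G u S0 i)%:E.
Proof.
rewrite ltm_prob_expect // reach_prob_expect //.
congr EFin; apply: expect_cascade_limit => x.
- exact: threshold_prob_total.
- exact: live_prob_total.
- by move=> S; rewrite threshold_prob_marginal // live_prob_marginal.
Qed.
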